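(* Let $p\in(0,1)$. In the trapping game on $\mathbb{Z}^2$ with trap density $p$, started from the origin, the probability that the first player wins (i.e. has a winning strategy), conditional on the origin being open, is $$\frac{1-2p+\sqrt{\frac{p}{4-3p}}}{2(1-p)}.$$
   Context: **The trapping game on $\mathbb{Z}^2$.** Each site of $\mathbb{Z}^2$ is independently a *trap* with probability $p$ and *open* with probability $1-p$. A token starts at the origin. Two players, who both know the whole configuration, move alternately; a move takes the token from its current site $x$ to $x+(1,0)$ or $x+(0,1)$. A player who moves the token to a trap loses immediately; otherwise the game continues with the other player's turn. A strategy for a player is a map assigning a legal move, where one exists, to each vertex; a winning strategy is one that results in a win for that player (in finitely many moves) whatever strategy the other player uses. *)

(* Defs.v *)
From HB Require Import structures.
From mathcomp Require Import all_boot all_order all_algebra.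
From mathcomp Require Import all_classical all_reals all_analysis.
Set Implicit Arguments.
Unset Strict Implicit.
Unset Printing Implicit Defensive.
Import Order.TTheory GRing.Theory Num.Theory.
Local Open Scope classical_set_scope.
Local Open Scope ring_scope.

Definition site : Type := (int * int)%type.

Definition origin : site := (0, 0).

Definition legal_move (x y : site) : Prop :=
  y = x + (1, 0) \/ y = x + (0, 1).

(* Every site has a legal move; moving to a trap is legal, but loses. *)
Definition strategy (s : site -> site) : Prop :=
  forall x, legal_move x (s x).

(* [play s1 s2 x n] is the position of the token after n moves from x, when the
   first player follows s1 and the second player s2. The first player makes
   the moves number 1, 3, 5, and so on. The sequence is continued past
   the end of the game, which is the first move to a trap. *)
Fixpoint play (s1 s2 : site -> site) (x : site) (n : nat) : site :=
  if n is m.+1 then (if odd m then s2 else s1) (play s1 s2 x m) else x.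

(* In the configuration with set of traps c, the token reaches a trap for the
   first time at a move made by the second player. The state of the
   starting site is irrelevant. *)
Definition first_player_wins_play (c : set site) (s1 s2 : site -> site)
    (x : site) : Prop :=
  exists n : nat, [/\ (0 < n)%N, ~~ odd n, c (play s1 s2 x n) &
    forall k : nat, (0 < k < n)%N -> ~ c (play s1 s2 x k)].

Definition first_player_wins (c : set site) (x : site) : Prop :=
  exists2 s1 : site -> site, strategy s1 &
    forall s2 : site -> site, strategy s2 -> first_player_wins_play c s1 s2 x.

Definition mutually_independent (d : measure_display) (T : measurableType d)
    (R : realType) (P : probability T R) (I : choiceType) (E : I -> set T) :
    Prop :=
  forall s : seq I, uniq s ->
    P (\bigcap_(i in [set` s]) E i) = (\prod_(i <- s) P (E i))%E.

(* [trap x] is the event that the site x is a trap. *)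
Definition iid_traps (d : measure_display) (T : measurableType d)
    (R : realType) (P : probability T R) (p : R) (trap : site -> set T) :
    Prop :=
  [/\ forall x, measurable (trap x),
      forall x, P (trap x) = p%:E &
      mutually_independent P (trap : int * int -> set T)].

Definition trap_sites (T : Type) (trap : site -> set T) (w : T) : set site :=
  [set x | trap x w].

Definition first_player_wins_event (T : Type) (trap : site -> set T) : set T :=
  [set w | first_player_wins (trap_sites trap w) origin].

Definition open_event (T : Type) (trap : site -> set T) (x : site) : set T :=
  ~` trap x.

Definition cond_prob (d : measure_display) (T : measurableType d)
    (R : realType) (P : probability T R) (A B : set T) : R :=
  fine (P (A `&` B)) / fine (P B).

(* Main.v *)
Require Import Defs.
From HB Require Import structures.
From mathcomp Require Import all_boot all_order all_algebra.
From mathcomp Require Import all_classical all_reals all_analysis.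
From mathcomp Require Import ring lra zify.
Set Implicit Arguments.
Unset Strict Implicit.
Unset Printing Implicit Defensive.
Import Order.TTheory GRing.Theory Num.Theory.
Import numFieldNormedType.Exports.
Local Open Scope classical_set_scope.
Local Open Scope ring_scope.

(* Call a site a win (Some false), a loss (Some true) or undetermined (None) for
   the player about to move from it when the game is stopped after n moves.
   Diagonal by diagonal, the outcomes evolve as a probabilistic cellular
   automaton started from the undetermined row.
   Undetermined sites die out: a suitable nonnegative weight of the two-letter
   patterns containing an undetermined site contracts by a factor 1 - p^3/4 at
   each step.  So the outcome at the origin is, up to an exponentially small
   error, independent of the boundary row, and its law may be computed from a
   random boundary row which is stationary for the automaton.  Such a row is
   supplied by the reversible hard-core Markov chain on the zigzag formed by two
   successive rows, whose parameter b solves (1 - p) (1 - b + b^2) = b, that is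
   b = (1 - s) / (1 + s) with s = sqrt (p / (4 - 3 p)). *)

(** * The automaton on finite rows and its transfer operator *)

Definition outcome := option bool.

(** One step of minimax under partial information. In the comments on rows, 0, 1 and ? stand for
    [Some false], [Some true] and [None]. *)
Definition outcome_step (a b : outcome) : outcome :=
  match a, b with
  | Some true, _ | _, Some true => Some false
  | Some false, Some false => Some true
  | _, _ => None
  end.

Definition row_step (u : seq outcome) : seq outcome :=
  if u is a :: u' then pairmap outcome_step a u' else [::].

(** A trap turns a letter into [Some false]: whoever moved there has lost, so the player due to move
    next has won. *)
Fixpoint trap_mean (R : realFieldType) (p : R) (f : seq outcome -> R)
    (u : seq outcome) : R :=
  if u is a :: u' then
    p * trap_mean p (fun w => f (Some false :: w)) u'
    + (1 - p) * trap_mean p (fun w => f (a :: w)) u'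
  else f [::].

(** Traps hit a row before it is stepped. Thus [iter n (transfer p) f u] is the mean of [f] over the
    row n steps after [u], the traps of that last row not yet placed. *)
Definition transfer (R : realFieldType) (p : R) (f : seq outcome -> R) :
    seq outcome -> R :=
  fun u => trap_mean p (f \o row_step) u.

Lemma size_row_step u : size (row_step u) = (size u).-1.
Proof. by case: u => //= a u; rewrite size_pairmap. Qed.

Lemma row_step_behead u : row_step (behead u) = behead (row_step u).
Proof. by case: u => [|a [|b u]]. Qed.

Lemma row_step_take k u : row_step (take k.+1 u) = take k (row_step u).
Proof.
case: u => [|a u] //=.
by elim: u a k => [|b u IH] a [|k] //=; rewrite IH.
Qed.

Lemma trap_mean_le (R : realFieldType) (p : R) f g u : 0 < p -> p < 1 ->
  (forall w, size w = size u -> f w <= g w) ->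
  trap_mean p f u <= trap_mean p g u.
Proof.
move=> p0 p1; elim: u f g => [|a u IH] f g fg /=; first exact: fg.
apply: lerD; apply: ler_wpM2l; try lra; apply: IH => w sw;
  by apply: fg; rewrite /= sw.
Qed.

Lemma eq_trap_mean (R : realFieldType) (p : R) f g u : f =1 g ->
  trap_mean p f u = trap_mean p g u.
Proof.
elim: u f g => [|a u IH] f g fg /=; first exact: fg.
by congr (_ * _ + _ * _); apply: IH => w.
Qed.

Lemma trap_meanD (R : realFieldType) (p : R) a b f g u :
  trap_mean p (fun w => a * f w + b * g w) u
  = a * trap_mean p f u + b * trap_mean p g u.
Proof. by elim: u f g => //= x u IH f g; rewrite !IH; ring. Qed.

Lemma trap_mean_cst (R : realFieldType) (p : R) c u :
  trap_mean p (fun=> c) u = c.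
Proof. by elim: u => //= x u ->; ring. Qed.

Lemma trap_mean_behead (R : realFieldType) (p : R) f u :
  trap_mean p (f \o behead) u = trap_mean p f (behead u).
Proof. by case: u => //= a u; rewrite -mulrDl addrC subrK mul1r. Qed.

Lemma trap_mean_take (R : realFieldType) (p : R) f k u :
  trap_mean p (f \o take k) u = trap_mean p f (take k u).
Proof.
elim: u f k => [|a u IH] f [|k] //=.
  by rewrite !trap_mean_cst; ring.
by congr (_ * _ + _ * _); rewrite -IH.
Qed.

Lemma eq_transfer (R : realFieldType) (p : R) n f g : f =1 g ->
  iter n (transfer p) f =1 iter n (transfer p) g.
Proof.
by move=> fg; elim: n => //= n IH u; apply: eq_trap_mean => w /=; rewrite IH.
Qed.

Lemma transfer_le (R : realFieldType) (p : R) n k f g : 0 < p -> p < 1 ->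
  (forall w, size w = k -> f w <= g w) ->
  forall u, size u = (n + k)%N ->
    iter n (transfer p) f u <= iter n (transfer p) g u.
Proof.
move=> p0 p1 fg; elim: n => //= n IH u su.
by apply: trap_mean_le => // w sw /=; apply: IH; rewrite size_row_step sw su.
Qed.

Lemma transferD (R : realFieldType) (p : R) n a b f g u :
  iter n (transfer p) (fun w => a * f w + b * g w) u
  = a * iter n (transfer p) f u + b * iter n (transfer p) g u.
Proof.
elim: n u => //= n IH u; rewrite /transfer -trap_meanD.
by apply: eq_trap_mean => w /=; rewrite IH.
Qed.

Lemma transfer_behead (R : realFieldType) (p : R) n f u :
  iter n (transfer p) (f \o behead) u = iter n (transfer p) f (behead u).
Proof.
elim: n u => //= n IH u; rewrite /transfer -trap_mean_behead.
by apply: eq_trap_mean => w /=; rewrite IH row_step_behead.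
Qed.

Lemma transfer_take (R : realFieldType) (p : R) n k f u :
  iter n (transfer p) (f \o take k) u = iter n (transfer p) f (take (n + k) u).
Proof.
elim: n u => //= n IH u; rewrite /transfer -trap_mean_take.
by apply: eq_trap_mean => w /=; rewrite IH row_step_take.
Qed.

(** * Exponential decay of undetermined sites *)

(* Every zero of a row comes from a one of the previous row, which produces two
   adjacent zeros; so an isolated zero cannot stand next to an undetermined
   site. *)
Definition good_triple (w : seq outcome) : bool :=
  if w is [:: a; b; c] then
    (b == Some false) ==> ((a == None) || (c == None)) ==>
      ((a == Some false) || (c == Some false))
  else false.

Lemma good_triple_row_step w : size w = 4 -> good_triple (row_step w).
Proof.
case: w => [|a [|b [|c [|d []]]]] //= _.
by case: a b c d => [[]|] [[]|] [[]|] [[]|].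
Qed.

Lemma transfer_le_good (R : realFieldType) (p : R) n f g : 0 < p -> p < 1 ->
  (forall w, good_triple w -> f w <= g w) ->
  iter n (transfer p) f (nseq (n + 3) None)
  <= iter n (transfer p) g (nseq (n + 3) None).
Proof.
move=> p0 p1 fg; case: n => [|n]; first exact: fg.
rewrite !iterSr; apply: (@transfer_le _ _ _ 4) => //.
  move=> w sw; apply: trap_mean_le => // w' sw'.
  by apply/fg/good_triple_row_step; rewrite sw'.
by rewrite size_nseq addSnnS.
Qed.

(* The weight is 1 on ??, 0?, ?0 and p + 1/2 on 1?, ?1.  Without traps (p = 0)
   it would be conserved up to the loss caused by the patterns 1?1. *)
Definition undetermined_weight (R : realFieldType) (p : R)
    (w : seq outcome) : R :=
  match w with
  | [:: None; None] | [:: None; Some false] | [:: Some false; None] => 1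
  | [:: None; Some true] | [:: Some true; None] => p + 1 / 2
  | _ => 0
  end.

(* A discrete divergence of this flow has mean zero under shift-invariant laws;
   it turns the decay of the weight into a pointwise inequality on triples. *)
Definition weight_flow (R : realFieldType) (p : R) (w : seq outcome) : R :=
  match w with
  | [:: Some false; None] => - (p * (1 - p) / 2)
  | [:: None; Some false] => p * (1 - p) / 2
  | [:: Some true; None] => 1 / 4 - p / 2
  | [:: None; Some true] => p / 2 - 1 / 4
  | _ => 0
  end.

(** A finite check over triples. On 0?? and ??0 the flow absorbs all of the loss but exactly p^3,
    which dictates the order of the factor; the 1/4 is slack. *)
Lemma transfer_weight_le (R : realFieldType) (p : R) w : 0 < p -> p < 1 ->
  good_triple w ->
  transfer p (undetermined_weight p) w
  <= (1 - p ^+ 3 / 4) / 2 * undetermined_weight p (take 2 w)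
     + (1 - p ^+ 3 / 4) / 2 * undetermined_weight p (behead w)
     + (1 * weight_flow p (take 2 w) + (-1) * weight_flow p (behead w)).
Proof.
move=> p0 p1; case: w => [|a [|b [|c []]]] //.
have q0 : 0 < 1 - p by lra.
case: a b c => [[]|] [[]|] [[]|] //= _; rewrite /transfer /=.
all: try nra.
(* These bounds serve the triple 1?1, whose new weight has mean p (1 - p) (2 - p). *)
have pq : p * (1 - p) <= 1 / 4 by have := sqr_ge0 (p - 1 / 2); nra.
have [t0 t1] : 0 <= p ^+ 3 /\ p ^+ 3 <= 1.
  by rewrite exprn_ge0 ?exprn_ile1 //; lra.
have tp : p ^+ 3 * (p + 1 / 2) <= 1 * (3 / 2) by apply: ler_pM => //; lra.
have qp : p * (1 - p) * (2 - p) <= 1 / 4 * 2.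
  by apply: ler_pM => //; [apply: mulr_ge0; lra | lra | lra].
by lra.
Qed.

Lemma weight_mean_le (R : realFieldType) (p : R) n : 0 < p -> p < 1 ->
  iter n (transfer p) (undetermined_weight p) (nseq (n + 2) None)
  <= (1 - p ^+ 3 / 4) ^+ n.
Proof.
move=> p0 p1; elim: n => // n IH.
rewrite addSnnS iterSr.
apply: le_trans (transfer_le_good _ p0 p1 _) _ => [w|].
  exact: transfer_weight_le.
set b := (1 - _); have b0 : 0 <= b.
  by have := exprn_ile1 3 (ltW p0) (ltW p1); rewrite /b; lra.
(* The constant row is shift-invariant, so both adjacent pairs of a triple have the same mean [D f],
   and the two flow terms cancel. *)
pose D f := iter n (transfer p) f (nseq (n + 2) None).
have HT f : iter n (transfer p) (f \o take 2) (nseq (n + 3) None) = D f.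
  by rewrite transfer_take take_nseq // leq_add2l.
have HB f : iter n (transfer p) (f \o behead) (nseq (n + 3) None) = D f.
  by rewrite transfer_behead addnS.
rewrite (@eq_transfer _ _ _ _ (fun w =>
  1 * (b / 2 * (undetermined_weight p \o take 2) w
       + b / 2 * (undetermined_weight p \o behead) w)
  + 1 * (1 * (weight_flow p \o take 2) w
         + (-1) * (weight_flow p \o behead) w))); last first.
  by move=> w; rewrite /= !mul1r.
rewrite !transferD !HT !HB.
move: (D (weight_flow p)) => e.
have -> : forall x, 1 * (b / 2 * x + b / 2 * x) + 1 * (1 * e + -1 * e) = b * x.
  by move=> x; field.
by rewrite exprS ler_wpM2l.
Qed.

Definition outcome_test (R : realFieldType) (a : outcome) (w : seq outcome) : R :=
  (w == [:: a])%:R.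

(** One letter after n steps depends on n + 1 letters of the initial row. [config_mean_outcome]
    links this number to the game. *)
Definition outcome_prob (R : realFieldType) (p : R) (n : nat) (a : outcome) : R :=
  iter n (transfer p) (outcome_test R a) (nseq n.+1 None).

(** An undetermined letter arises only from a pair that contains one, and each such pair has weight
    at least 1/2. *)
Lemma undetermined_prob_le (R : realFieldType) (p : R) n : 0 < p -> p < 1 ->
  outcome_prob p n.+1 None <= 2 * (1 - p ^+ 3 / 4) ^+ n.
Proof.
move=> p0 p1; rewrite /outcome_prob iterSr.
have H := weight_mean_le n p0 p1.
pose M f := iter n (transfer p) f (nseq n.+2 None).
apply: le_trans (_ : _ <= 2 * M (undetermined_weight p)) _; last first.
  by rewrite ler_pM2l // /M -(addn2 n).
(* The vanishing second term gives the bound the two-term shape of [transferD]. *)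
rewrite -[leRHS]addr0 -[X in _ + X](mul0r (M (fun=> 0))) /M -transferD.
apply: (@transfer_le _ _ _ 2) => //; last by rewrite size_nseq addn2.
case=> [|a [|b []]] // _; rewrite /transfer /outcome_test /=.
by case: a b => [[]|] [[]|] /=; nra.
Qed.

(** * Monotonicity in the information order *)

Definition outcome_le (a b : outcome) : bool := (a == None) || (a == b).

Lemma outcome_step_le a b c d : outcome_le a c -> outcome_le b d ->
  outcome_le (outcome_step a b) (outcome_step c d).
Proof. by case: a b c d => [[]|] [[]|] [[]|] [[]|]. Qed.

Lemma row_step_le u v :
  all2 outcome_le u v -> all2 outcome_le (row_step u) (row_step v).
Proof.
case: u v => [|a u] [|b v] //= /andP[].
elim: u v a b => [|c u IH] [|d v] a b //= ab /andP[cd uv].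
by rewrite IH // andbT outcome_step_le.
Qed.

Lemma trap_mean_homo (R : realFieldType) (p : R) f u v : 0 < p -> p < 1 ->
  {homo f : u v / all2 outcome_le u v >-> u <= v} ->
  all2 outcome_le u v -> trap_mean p f u <= trap_mean p f v.
Proof.
move=> p0 p1; elim: u v f => [|a u IH] [|b v] f fh //=.
move=> /andP[ab uv]; apply: lerD; apply: ler_wpM2l; try lra; last first.
  apply: le_trans (_ : _ <= trap_mean p (fun w => f (a :: w)) v) _.
    by apply: IH => // w w' ww'; apply: fh; rewrite /= ww' /outcome_le eqxx orbT.
  apply: trap_mean_le => // w _; apply: fh; rewrite /= ab.
  by elim: w => //= c w ->; rewrite /outcome_le eqxx orbT.
by apply: IH => // w w' ww'; apply: fh.
Qed.

Lemma transfer_homo (R : realFieldType) (p : R) n f : 0 < p -> p < 1 ->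
  {homo f : u v / all2 outcome_le u v >-> u <= v} ->
  {homo iter n (transfer p) f : u v / all2 outcome_le u v >-> u <= v}.
Proof.
move=> p0 p1 fh; elim: n => //= n IH u v; apply: trap_mean_homo => // w w' ww'.
exact/IH/row_step_le.
Qed.

Lemma all2_outcome_le_nseq w : all2 outcome_le (nseq (size w) None) w.
Proof. by elim: w. Qed.

(** * The stationary hard-core chain and the comparison with it *)

(* The hard-core Markov chain, with no two adjacent ones, run along the zigzag
   that visits alternately the sites of two successive rows. *)
Definition zigzag (R : realFieldType) (b : R) (x y : bool) : R :=
  if x then (~~ y)%:R else if y then b else 1 - b.

(** Transition between neighbours of one row, summed over the site of the other row between them. *)
Definition zigzag2 (R : realFieldType) (b : R) (x y : bool) : R :=
  zigzag b x false * zigzag b false y + zigzag b x true * zigzag b true y.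

Fixpoint chain_mean (R : realFieldType) (b : R) (k : nat)
    (f : seq outcome -> R) (x : bool) : R :=
  if k is k'.+1 then
    zigzag2 b x false * chain_mean b k' (fun w => f (Some false :: w)) false
    + zigzag2 b x true * chain_mean b k' (fun w => f (Some true :: w)) true
  else f [::].

(* The rows have k + 1 letters. *)
Definition stationary_mean (R : realFieldType) (b : R) (k : nat)
    (f : seq outcome -> R) : R :=
  (1 + b)^-1 * chain_mean b k (fun w => f (Some false :: w)) false
  + b / (1 + b) * chain_mean b k (fun w => f (Some true :: w)) true.

Lemma chain_meanD (R : realFieldType) (b : R) k s t f g x :
  chain_mean b k (fun w => s * f w + t * g w) x
  = s * chain_mean b k f x + t * chain_mean b k g x.
Proof. by elim: k f g x => //= k IH f g x; rewrite !IH; ring. Qed.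

Lemma chain_mean_cst (R : realFieldType) (b : R) k c x :
  chain_mean b k (fun=> c) x = c.
Proof.
elim: k x => //= k IH x; rewrite !IH /zigzag2 /zigzag.
by case: x => /=; ring.
Qed.

(** The reason is local: for old neighbours x, y and the new letter v between them, [zigzag2 b x y]
    times the probability of v given x and y equals [zigzag b x v * zigzag b v y]. For x = y = 0 and
    v = 1 this is the equation on b. *)
Lemma chain_mean_trap (R : realFieldType) (p b : R) k f x :
  (1 - p) * (1 - b + b ^+ 2) = b ->
  chain_mean b k.+1 (fun w => trap_mean p f (row_step (Some x :: w))) x
  = zigzag b x false * chain_mean b k (fun w => f (Some false :: w)) false
    + zigzag b x true * chain_mean b k (fun w => f (Some true :: w)) true.
Proof.
move=> hb.
(* Here [v] is the new letter just drawn and [y] the next old letter. *)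
pose X k f v y := chain_mean b k
  (fun w => trap_mean p (fun w' => f (Some v :: w')) (row_step (Some y :: w))) y.
have A k' g a :
    chain_mean b k'.+1 (fun w => trap_mean p g (row_step (Some a :: w))) a
    = zigzag b a false * (zigzag b false false * X k' g false false
                          + zigzag b false true * X k' g false true)
      + zigzag b a true * (zigzag b true false * X k' g true false
                          + zigzag b true true * X k' g true true).
  case: a => /=; rewrite !chain_meanD -/(X k' g false false) -/(X k' g false true)
    -?/(X k' g true false); rewrite /zigzag2 /zigzag /=.
    by ring.
  set X0 := X _ _ _ _; set X1 := X _ _ _ _; set X2 := X _ _ _ _.
  have -> : ((1 - b) * (1 - b) + b * 1) * (p * X0 + (1 - p) * X1)
    = (1 - b + b ^+ 2 - (1 - p) * (1 - b + b ^+ 2)) * X0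
      + (1 - p) * (1 - b + b ^+ 2) * X1 by ring.
  by rewrite hb; ring.
elim: k f x => [|k IH] f x; rewrite A.
  by rewrite /X /= /zigzag /=; case: x => /=; ring.
have B v : zigzag b v false * X k.+1 f v false + zigzag b v true * X k.+1 f v true
    = chain_mean b k.+1 (fun w => f (Some v :: w)) v.
  rewrite /X !IH /= /zigzag2.
  move: (chain_mean _ _ _ false) (chain_mean _ _ _ true) => c d.
  by rewrite /zigzag; case: v => /=; ring.
by rewrite !B.
Qed.

(** The initial weights 1 / (1 + b) and b / (1 + b) are invariant under [zigzag], so the new row
    starts with the law of the old one. *)
Lemma stationary_mean_trap (R : realFieldType) (p b : R) k f :
  0 <= b -> (1 - p) * (1 - b + b ^+ 2) = b ->
  stationary_mean b k.+1 (trap_mean p f \o row_step) = stationary_mean b k f.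
Proof.
move=> b0 hb; rewrite {1}/stationary_mean !chain_mean_trap // /stationary_mean.
by rewrite /zigzag /=; field; apply/eqP; lra.
Qed.

(** The stationary law is that of rows with traps already placed, whereas [transfer] places them
    first; the extra [row_step] bridges this half step. *)
Lemma stationary_mean_transfer (R : realFieldType) (p b : R) n f :
  0 <= b -> (1 - p) * (1 - b + b ^+ 2) = b ->
  stationary_mean b n.+1 (iter n (transfer p) f \o row_step)
  = stationary_mean b 1 (f \o row_step).
Proof.
move=> b0 hb; elim: n => // n IH; rewrite -IH.
exact: stationary_mean_trap.
Qed.

Lemma chain_mean_le (R : realFieldType) (b : R) k f g x : 0 <= b -> b <= 1 ->
  (forall s : seq bool, size s = k -> f (map Some s) <= g (map Some s)) ->
  chain_mean b k f x <= chain_mean b k g x.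
Proof.
move=> b0 b1; elim: k f g x => [|k IH] f g x fg; first exact: (fg [::]).
have z y : 0 <= zigzag2 b x y.
  by rewrite /zigzag2 /zigzag; case: x y => [] [] /=; nra.
apply: lerD; apply: ler_wpM2l => //; apply: IH => s sk.
  by apply: (fg (false :: s)); rewrite /= sk.
by apply: (fg (true :: s)); rewrite /= sk.
Qed.

Lemma stationary_mean_le (R : realFieldType) (b : R) k f g : 0 <= b -> b <= 1 ->
  (forall s : seq bool, size s = k.+1 -> f (map Some s) <= g (map Some s)) ->
  stationary_mean b k f <= stationary_mean b k g.
Proof.
move=> b0 b1 fg; have h : 0 <= (1 + b)^-1 by rewrite invr_ge0; lra.
apply: lerD; apply: ler_wpM2l; rewrite ?mulr_ge0 //; apply: chain_mean_le => // s sk.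
  by apply: (fg (false :: s)); rewrite /= sk.
by apply: (fg (true :: s)); rewrite /= sk.
Qed.

Lemma stationary_mean_cst (R : realFieldType) (b : R) k c : 0 <= b ->
  stationary_mean b k (fun=> c) = c.
Proof.
by move=> b0; rewrite /stationary_mean !chain_mean_cst; field; apply/eqP; lra.
Qed.

(** The all-? row lies below every row, so starting from it can only lower the probabilities of a
    win and of a loss. The middle term is the stationary probability that two neighbours are not
    both 0. *)
Lemma win_prob_bounds (R : realFieldType) (p b : R) n : 0 < p -> p < 1 ->
  0 <= b -> b <= 1 -> (1 - p) * (1 - b + b ^+ 2) = b ->
  outcome_prob p n (Some false) <= 1 - (1 - b + b ^+ 2) / (1 + b)
    <= outcome_prob p n (Some false) + outcome_prob p n None.
Proof.
move=> p0 p1 b0 b1 hb; rewrite /outcome_prob.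
pose N a := iter n (transfer p) (outcome_test R a) (nseq n.+1 None).
rewrite -/(N (Some false)) -/(N None).
have qE : stationary_mean b n.+1
    (iter n (transfer p) (outcome_test R (Some false)) \o row_step)
    = 1 - (1 - b + b ^+ 2) / (1 + b).
  rewrite stationary_mean_transfer // /stationary_mean /= /outcome_test /=.
  by rewrite /zigzag2 /zigzag /=; field; apply/eqP; lra.
(* On one letter [L] indicates a win or an undetermined outcome; [- L] is monotone in the
   information order. *)
pose L w := 1 - outcome_test R (Some true) w : R.
have NL : iter n (transfer p) (fun w => - L w) (nseq n.+1 None)
    = - (N (Some false) + N None).
  have -> : - (N (Some false) + N None) = -1 * N (Some false) + -1 * N None.
    by ring.
  rewrite -transferD; apply: le_anti.
  have E w : size w = 1 -> - L w =
      -1 * outcome_test R (Some false) w + -1 * outcome_test R None w.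
    by case: w => [|[[]|] []] // _; rewrite /L /outcome_test /=; ring.
  by apply/andP; split; apply: (@transfer_le _ _ _ 1) => //;
    rewrite ?size_nseq ?addn1 // => w sw; rewrite E.
have homo1 : {homo outcome_test R (Some false) : u v / all2 outcome_le u v >-> u <= v}.
  move=> [|[[]|] [|? ?]] [|[[]|] [|? ?]] //=; rewrite /outcome_test /=; lra.
have homo2 : {homo (fun w => - L w) : u v / all2 outcome_le u v >-> u <= v}.
  rewrite /L; move=> [|[[]|] [|? ?]] [|[[]|] [|? ?]] //=; rewrite /outcome_test /=; lra.
have below (s : seq bool) : size s = n.+2 ->
    all2 outcome_le (nseq n.+1 None) (row_step (map Some s)).
  move=> sn; suff -> : n.+1 = size (row_step (map Some s)).
    exact: all2_outcome_le_nseq.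
  by rewrite size_row_step size_map sn.
apply/andP; split; rewrite -qE.
  rewrite -(@stationary_mean_cst _ b n.+1 (N (Some false))) //.
  apply: stationary_mean_le => // s sn; apply: transfer_homo => //; exact: below.
rewrite -[leRHS](@stationary_mean_cst _ b n.+1) //.
apply: stationary_mean_le => // s sn /=.
rewrite -[leRHS]opprK -NL lerNr.
apply: le_trans (transfer_homo n p0 p1 homo2 (below _ sn)) _.
rewrite -[leRHS]mulN1r -[leRHS]addr0
  -[X in _ + X](mul0r (iter n (transfer p) (fun=> 0) (row_step (map Some s)))).
rewrite -transferD; apply: (@transfer_le _ _ _ 1) => //.
  case=> [|a []] // _; rewrite /L /outcome_test.
  by case: a => [[]|] /=; lra.
by rewrite size_row_step size_map sn addn1.
Qed.

(** * Outcomes of the stopped game and winning strategies *)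

(* The state of the starting site x is ignored; [arrival] takes it into account,
   a trap being a win for the player who is about to move from it. *)
Fixpoint outcome_within (c : site -> bool) (n : nat) (x : site) : outcome :=
  if n is m.+1 then
    let arrive y := if c y then Some false else outcome_within c m y in
    outcome_step (arrive (x + (1, 0))) (arrive (x + (0, 1)))
  else None.

Definition arrival (c : site -> bool) (n : nat) (y : site) : outcome :=
  if c y then Some false else outcome_within c n y.

Lemma outcome_withinS c n x : outcome_within c n.+1 x =
  outcome_step (arrival c n (x + (1, 0))) (arrival c n (x + (0, 1))).
Proof. by []. Qed.

Lemma outcome_within_le c m n x : (m <= n)%N ->
  outcome_le (outcome_within c m x) (outcome_within c n x).
Proof.
elim: m n x => // m IH [|n] x // mn; rewrite !outcome_withinS.
have h y : outcome_le (arrival c m y) (arrival c n y).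
  by rewrite /arrival; case: ifP => // _; exact: IH.
by apply: outcome_step_le.
Qed.

Lemma arrival_le c m n x : (m <= n)%N ->
  outcome_le (arrival c m x) (arrival c n x).
Proof. by move=> mn; rewrite /arrival; case: ifP => // _; exact: outcome_within_le. Qed.

(** The level acts as a clock, since each move raises it by one; it also separates a site from those
    its outcome depends on. *)
Definition level (x : site) : int := x.1 + x.2.

Lemma legal_level x y : legal_move x y -> level y = level x + 1.
Proof. by case=> ->; case: x => a b; rewrite /level /=; ring. Qed.

Lemma play_level s1 s2 x m : strategy s1 -> strategy s2 ->
  level (play s1 s2 x m) = level x + m%:Z.
Proof.
move=> h1 h2; elim: m => [|m IH]; first by rewrite addr0.
have -> : level (play s1 s2 x m.+1) = level (play s1 s2 x m) + 1.
  by apply: legal_level => /=; case: ifP.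
by rewrite IH; lia.
Qed.

(* The remaining number of moves is read off the level of the site, which makes
   the following strategy positional. *)
Definition bounded_strategy (c : site -> bool) (N : nat) (x y : site) : site :=
  if arrival c (N - `|level y - level x|).-1 (y + (1, 0)) == Some true
  then y + (1, 0) else y + (0, 1).

Lemma bounded_strategyP c N x : strategy (bounded_strategy c N x).
Proof. by move=> y; rewrite /bounded_strategy; case: ifP => _; [left|right]. Qed.

(** Invariant: at each even time m before the end, the token stands on a win within N - m moves.
    With no moves left the value is [None], so the second player must hit a trap earlier. *)
Lemma outcome_within_wins c N x : outcome_within c N x = Some false ->
  first_player_wins [set z | c z] x.
Proof.
move=> xW; exists (bounded_strategy c N x); first exact: bounded_strategyP.
move=> s2 s2P; set s1 := bounded_strategy c N x.
have s1P : strategy s1 := bounded_strategyP c N x.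
suff H n m : ~~ odd m -> (m + n)%N = N ->
    outcome_within c n (play s1 s2 x m) = Some false ->
    (forall k, (0 < k <= m)%N -> ~ c (play s1 s2 x k)) ->
    first_player_wins_play [set z | c z] s1 s2 x.
  by apply: (H N 0%N) => // k; case: k.
elim/ltn_ind: n m => -[|n] IH m // em mN; rewrite outcome_withinS => W opn.
set y := play s1 s2 x m in W.
have sy : play s1 s2 x m.+1 = s1 y by rewrite /= (negbTE em).
have zT : arrival c n (s1 y) = Some true.
  rewrite /s1 /bounded_strategy play_level // addrAC subrr add0r.
  have -> : (N - `|m%:Z|).-1 = n by lia.
  case: eqP => [->//|]; move: W.
  by case: (arrival _ _ _) => [[]|] //; case: (arrival _ _ _) => [[]|].
have [zc zo] : ~~ c (s1 y) /\ outcome_within c n (s1 y) = Some true.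
  by move: zT; rewrite /arrival; case: ifP.
case: n zo IH mN W zT => // n; rewrite outcome_withinS => zo IH mN _ _.
have [e1 e2] : arrival c n (s1 y + (1, 0)) = Some false
    /\ arrival c n (s1 y + (0, 1)) = Some false.
  by move: zo; do 2! case: (arrival _ _ _) => [[]|] //.
have sz : play s1 s2 x m.+2 = s2 (s1 y) by rewrite -sy /= em.
have tz : arrival c n (s2 (s1 y)) = Some false by case: (s2P (s1 y)) => ->.
have opn1 k : (0 < k < m.+2)%N -> ~ c (play s1 s2 x k).
  move=> km; have [->|kne] := eqVneq k m.+1; first by rewrite sy; apply/negP.
  by apply: opn; lia.
case: (boolP (c (s2 (s1 y)))) => cz.
  by exists m.+2; split => //=; rewrite ?negbK //= -/(play s1 s2 x m.+2) -?sz //;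
    rewrite sz.
apply: (IH n _ m.+2) => //=; rewrite ?negbK //; try lia.
  by rewrite -/(play s1 s2 x m.+2) sz; move: tz; rewrite /arrival (negbTE cz).
move=> k km; have [->|kne] := eqVneq k m.+2; first by rewrite sz; apply/negP.
by apply: opn1; lia.
Qed.

(** The second player avoids sites where the opponent's win shows up after some number of moves;
    traps are among them. *)
Definition evading_strategy (c : site -> bool) (z : site) : site :=
  if `[< forall n, arrival c n (z + (1, 0)) <> Some false >]
  then z + (1, 0) else z + (0, 1).

Lemma evading_strategyP c : strategy (evading_strategy c).
Proof. by move=> y; rewrite /evading_strategy; case: ifP => _; [left|right]. Qed.

Lemma wins_outcome_within (c : site -> bool) x : first_player_wins [set z | c z] x ->
  exists n, outcome_within c n x = Some false.
Proof.
case=> s1 s1P /(_ _ (evading_strategyP c)) [n [n0 en cn opn]].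
apply: contrapT => /forallNP NW.
set s2 := evading_strategy c in cn opn.
suff H m : (forall k, (0 < k < m.*2)%N -> ~ c (play s1 s2 x k)) ->
    (forall n, outcome_within c n (play s1 s2 x m.*2) <> Some false)
    /\ ((0 < m)%N -> ~ c (play s1 s2 x m.*2)).
  have nE : (n./2).*2 = n by have := odd_double_half n; rewrite (negbTE en).
  by have [|_] := H n./2; rewrite nE // => /(_ _)/(_ _) []//; lia.
elim: m => [|m IH] opm; first by split.
have {IH}[|W _] := IH; first by move=> k km; apply: opm; lia.
set y := play s1 s2 x m.*2 in W.
have sy : play s1 s2 x m.*2.+1 = s1 y by rewrite /= odd_double.
have zc : ~ c (s1 y) by rewrite -sy; apply: opm; lia.
have zW k : outcome_within c k (s1 y) <> Some true.
  have := W k.+1; rewrite outcome_withinS.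
  have -> : outcome_within c k (s1 y) = arrival c k (s1 y).
    by rewrite /arrival; case: ifP.
  by case: (s1P y) => ->; do 2! case: (arrival _ _ _) => [[]|] //.
have sz : play s1 s2 x m.*2.+2 = s2 (s1 y) by rewrite -sy /= odd_double.
have ev k : arrival c k (s2 (s1 y)) <> Some false.
  rewrite /s2 /evading_strategy; case: asboolP => [|] A; first exact: A.
  (* If both neighbours are won for the first player, within j and k moves, then the maximum works
     for both, and [s1 y] would be a loss for the second player. *)
  move=> E; apply: A => j E'; apply: (zW (maxn j k).+1); rewrite outcome_withinS.
  have := @arrival_le c _ _ (s1 y + (1, 0)) (leq_maxl j k).
  have := @arrival_le c _ _ (s1 y + (0, 1)) (leq_maxr j k).
  by rewrite E E' /outcome_le /= => /eqP <- /eqP <-.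
rewrite doubleS sz; split=> [k E|_ cz].
  by apply: (ev k); rewrite /arrival E; case: ifP.
by apply: (ev 0%N); rewrite /arrival cz.
Qed.

Lemma first_player_winsP (c : site -> bool) x : first_player_wins [set z | c z] x <->
  exists n, outcome_within c n x = Some false.
Proof.
by split=> [|[n]]; [exact: wins_outcome_within | exact: outcome_within_wins].
Qed.

(** * Averages over the states of finitely many sites *)

Definition update (c : site -> bool) (x : site) (b : bool) : site -> bool :=
  fun z => if z == x then b else c z.

Fixpoint config_mean (R : realFieldType) (p : R) (s : seq site)
    (F : (site -> bool) -> R) (c : site -> bool) : R :=
  if s is x :: s' then
    p * config_mean p s' F (update c x true)
    + (1 - p) * config_mean p s' F (update c x false)
  else F c.

Lemma config_mean_cat (R : realFieldType) (p : R) s t F c :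
  config_mean p (s ++ t) F c = config_mean p s (config_mean p t F) c.
Proof. by elim: s c => //= x s IH c; rewrite !IH. Qed.

Lemma eq_config_mean (R : realFieldType) (p : R) s F G c :
  (forall c', (forall z, z \notin s -> c' z = c z) -> F c' = G c') ->
  config_mean p s F c = config_mean p s G c.
Proof.
elim: s c => [|x s IH] c FG /=; first exact: FG.
by congr (_ * _ + _ * _); apply: IH => c' h; apply: FG => z;
  rewrite inE negb_or => /andP[zx zs]; rewrite h // /update (negbTE zx).
Qed.

Fixpoint diagonal (y : site) (k : nat) : seq site :=
  if k is k'.+1 then y :: diagonal (y + (-1, 1)) k' else [::].

(** Far diagonals come first, so that [config_mean] averages over the nearest diagonal innermost. *)
Fixpoint dependence_sites (n : nat) (y : site) (k : nat) : seq site :=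
  if n is m.+1 then
    dependence_sites m (y + (1, 0)) k.+1 ++ diagonal (y + (1, 0)) k.+1
  else [::].

Lemma diagonal_level y k z : z \in diagonal y k ->
  level z = level y /\ z.1 <= y.1.
Proof.
elim: k y => //= k IH y; rewrite inE => /orP[/eqP ->//|/IH].
by rewrite /level; case: y => a b /= [-> h] ; split; lia.
Qed.

Lemma diagonal_uniq y k : uniq (diagonal y k).
Proof.
elim: k y => //= k IH y; rewrite IH andbT; apply/negP => /diagonal_level[_].
by case: y => a b /=; lia.
Qed.

Lemma dependence_sites_level n y k z :
  z \in dependence_sites n y k -> level y < level z.
Proof.
elim: n y k => //= n IH y k.
have h : level (y + (1, 0)) = level y + 1 by apply: legal_level; left.
rewrite mem_cat => /orP[/IH|/(@diagonal_level _ k.+1)[-> _]]; rewrite h.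
  by apply: lt_trans; rewrite ltrDl.
by rewrite ltrDl.
Qed.

Lemma dependence_sites_uniq n y k : uniq (dependence_sites n y k).
Proof.
elim: n y k => // n IH y k.
rewrite [dependence_sites _ _ _]/(_ ++ _) cat_uniq IH diagonal_uniq andbT.
apply/hasPn => z /diagonal_level[zl _]; apply/negP => /dependence_sites_level.
by rewrite zl ltxx.
Qed.

Lemma row_step_arrival c n y k :
  row_step (map (arrival c n) (diagonal (y + (1, 0)) k.+1))
  = map (outcome_within c n.+1) (diagonal y k).
Proof.
have e1 (z : site) : z + (1, 0) + (-1, 1) = z + (0, 1).
  by case: z => a b; congr pair => /=; ring.
have e2 (z : site) : z + (0, 1) = z + (-1, 1) + (1, 0).
  by case: z => a b; congr pair => /=; ring.
elim: k y => // k IH y.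
rewrite [RHS]/= -IH [in LHS]/= e1 -outcome_withinS e2 /=.
by [].
Qed.

Lemma outcome_within_local c c' n x :
  (forall z, level x < level z -> c z = c' z) ->
  outcome_within c n x = outcome_within c' n x.
Proof.
elim: n x => // n IH x h; rewrite !outcome_withinS.
have A y : legal_move x y -> arrival c n y = arrival c' n y.
  move=> /legal_level e; rewrite /arrival h ?e ?ltrDl // IH // => z zl.
  by apply: h; lia.
by rewrite !A; [|right|left].
Qed.

Lemma outcome_within_dependence c c' n y k :
  {in dependence_sites n y k, c =1 c'} ->
  {in diagonal y k, outcome_within c n =1 outcome_within c' n}.
Proof.
move=> h; apply/eq_in_map; elim: n y k h => // n IH y k h.
rewrite -!row_step_arrival; congr row_step; apply/eq_in_map => z zd.
rewrite /arrival h ?mem_cat ?zd ?orbT //.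
have /eq_in_map -> // : map (outcome_within c n) (diagonal (y + (1, 0)) k.+1) =
  map (outcome_within c' n) (diagonal (y + (1, 0)) k.+1).
by apply: IH => u us; apply: h; rewrite /= mem_cat us.
Qed.

(** Outcomes on a level ignore the states of that level, so averaging over these states only places
    traps on a fixed row. *)
Lemma config_mean_arrival (R : realFieldType) (p : R) r n h c l :
  uniq r -> {in r, forall z, level z = l} ->
  config_mean p r (fun c' => h (map (arrival c' n) r)) c
  = trap_mean p h (map (outcome_within c n) r).
Proof.
elim: r h c => //= x r IH h c /andP[xr ur] lev.
have levx : level x = l by apply: lev; rewrite mem_head.
have levr : {in r, forall z, level z = l}.
  by move=> z zr; apply: lev; rewrite inE zr orbT.
have upd b : map (outcome_within (update c x b) n) r = map (outcome_within c n) r.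
  apply/eq_in_map => z zr; apply: outcome_within_local => u.
  by rewrite (levr _ zr) -levx /update; case: eqP => // ->; rewrite ltxx.
have cx b c' : (forall z, z \notin r -> c' z = update c x b z) ->
    c' x = b /\ outcome_within c' n x = outcome_within c n x.
  move=> hc; split; first by rewrite hc // /update eqxx.
  apply: outcome_within_local => u; rewrite levx => lu.
  rewrite hc; last by apply/negP => /levr ul; rewrite ul ltxx in lu.
  by rewrite /update; case: eqP lu => // ->; rewrite levx ltxx.
congr (_ * _ + _ * _).
  rewrite -(upd true) -IH //; apply: eq_config_mean => c' /cx[c'x _].
  by rewrite {1}/arrival c'x.
rewrite -(upd false) -IH //; apply: eq_config_mean => c' /cx[c'x e].
by rewrite {1}/arrival c'x e.
Qed.

(** The innermost average, over the nearest diagonal, is one [transfer]; induction handles the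
    farther diagonals. *)
Lemma config_mean_outcome_within (R : realFieldType) (p : R) n y k f c :
  config_mean p (dependence_sites n y k)
    (fun c' => f (map (outcome_within c' n) (diagonal y k))) c
  = iter n (transfer p) f (nseq (n + k) None).
Proof.
elim: n y k f => [|n IH] y k f.
  rewrite /=; congr f; elim: k y => //= k IH y; by rewrite IH.
rewrite [dependence_sites _ _ _]/(_ ++ _) config_mean_cat iterSr addSnnS.
rewrite -(IH (y + (1, 0))).
apply: eq_config_mean => c' _.
rewrite /transfer -(@config_mean_arrival _ _ _ _ _ _ (level (y + (1, 0)))).
- by apply: eq_config_mean => c'' _ /=; rewrite -row_step_arrival.
- exact: diagonal_uniq.
- by move=> z /diagonal_level[].
Qed.

Lemma config_mean_outcome (R : realFieldType) (p : R) n x a c :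
  config_mean p (dependence_sites n x 1)
    (fun c' => (outcome_within c' n x == a)%:R) c
  = outcome_prob p n a.
Proof.
rewrite /outcome_prob -(addn1 n) -(config_mean_outcome_within _ _ x _ _ c).
by apply: eq_config_mean => c' _; rewrite /outcome_test /= eqseq_cons andbT.
Qed.

(** * Independent traps and probabilities of local events *)

Definition config (T : Type) (trap : site -> set T) (w : T) : site -> bool :=
  fun x => w \in trap x.

(* The case t = [::] says that A has probability a. *)
Definition independent_traps (d : measure_display) (T : measurableType d)
    (R : realType) (P : probability T R) (p : R) (trap : site -> set T)
    (A : set T) (a : R) (s : seq site) : Prop :=
  measurable A /\ forall t : seq site, uniq t -> {subset t <= s} ->
    P (A `&` \bigcap_(x in [set` t]) trap x) = (a * p ^+ size t)%:E.

Lemma bigcap_seq_cons (T : Type) (I : eqType) (F : I -> set T) x t :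
  \bigcap_(i in [set` x :: t]) F i = F x `&` \bigcap_(i in [set` t]) F i.
Proof.
apply/seteqP; split=> w /=.
  move=> h; split=> [|i /= it]; apply: h => /=; first exact: mem_head.
  by rewrite inE it orbT.
by move=> [hx ht] i /=; rewrite inE => /orP[/eqP ->//|/ht].
Qed.

Lemma measurable_bigcap_seq (d : measure_display) (T : measurableType d)
    (trap : site -> set T) (t : seq site) :
  (forall x, measurable (trap x)) -> measurable (\bigcap_(x in [set` t]) trap x).
Proof.
move=> mt; elim: t => [|x t IH]; first by rewrite set_nil bigcap_set0.
by rewrite bigcap_seq_cons; apply: measurableI.
Qed.

Lemma independent_traps_setT (d : measure_display) (T : measurableType d)
    (R : realType) (P : probability T R) (p : R) (trap : site -> set T) s :
  iid_traps P p trap -> independent_traps P p trap setT 1 s.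
Proof.
case=> mt Pt ind; split=> // t ut _; rewrite setTI (ind t ut) mul1r.
elim: t {ut} => [|x t IH]; first by rewrite big_nil.
by rewrite big_cons IH Pt -EFinM -exprS.
Qed.

Lemma independent_traps_prob (d : measure_display) (T : measurableType d)
    (R : realType) (P : probability T R) (p : R) (trap : site -> set T) A a s :
  independent_traps P p trap A a s -> P A = a%:E.
Proof.
case=> _ /(_ [::] isT); rewrite set_nil bigcap_set0 setIT mulr1; exact.
Qed.

Lemma independent_traps_trap (d : measure_display) (T : measurableType d)
    (R : realType) (P : probability T R) (p : R) (trap : site -> set T) A a x s :
  (forall y, measurable (trap y)) -> x \notin s ->
  independent_traps P p trap A a (x :: s) ->
  independent_traps P p trap (A `&` trap x) (a * p) s.
Proof.
move=> mt xs [mA ind]; split; first exact: measurableI.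
move=> t ut ts; rewrite -setIA -bigcap_seq_cons ind ?exprS ?mulrA //=.
  by rewrite ut andbT; apply: contra xs => /ts.
by move=> y; rewrite !inE => /orP[->//|/ts ->]; rewrite orbT.
Qed.

Lemma independent_traps_open (d : measure_display) (T : measurableType d)
    (R : realType) (P : probability T R) (p : R) (trap : site -> set T) A a x s :
  (forall y, measurable (trap y)) -> x \notin s ->
  independent_traps P p trap A a (x :: s) ->
  independent_traps P p trap (A `&` ~` trap x) (a * (1 - p)) s.
Proof.
move=> mt xs ind; have [mA indA] := ind.
split; first by apply: measurableI => //; exact: measurableC.
move=> t ut ts; have [_ /(_ t ut ts)] := independent_traps_trap mt xs ind.
set C := \bigcap_(y in _) _ => Px.
have mC : measurable C by exact: measurable_bigcap_seq.
have mAC : measurable (A `&` C) by exact: measurableI.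
have PC : P (A `&` C) = (a * p ^+ size t)%:E.
  by apply: indA => // y /ts; rewrite inE => ->; rewrite orbT.
have : P (A `&` C) = (P (A `&` C `\` trap x) + P (A `&` C `&` trap x))%E.
  exact: measureDI.
rewrite PC.
have -> : A `&` C `&` trap x = A `&` trap x `&` C by rewrite setIAC.
have -> : A `&` C `\` trap x = A `&` ~` trap x `&` C by rewrite setDE setIAC.
rewrite Px; have : P (A `&` ~` trap x `&` C) \is a fin_num.
  by apply: fin_num_measure; do ?apply: measurableI => //; exact: measurableC.
move=> /fineK h; rewrite -h => /(congr1 fine) /= e; congr EFin.
have -> : a * (1 - p) * p ^+ size t = a * p ^+ size t - a * p * p ^+ size t by ring.
by rewrite e addrK.
Qed.

(** Induction on the sites: split according to the state of x, absorb that state into [A], and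
    freeze it in [F]. *)
Lemma prob_config (d : measure_display) (T : measurableType d)
    (R : realType) (P : probability T R) (p : R) (trap : site -> set T) A a s
    (F : (site -> bool) -> bool) c :
  (forall y, measurable (trap y)) -> uniq s ->
  independent_traps P p trap A a s ->
  (forall c c', {in s, c =1 c'} -> F c = F c') ->
  measurable (A `&` [set w | F (config trap w)])
  /\ P (A `&` [set w | F (config trap w)])
     = (a * config_mean p s (fun c => (F c)%:R) c)%:E.
Proof.
move=> mt; elim: s A a F c => [|x s IH] A a F c /=.
  move=> _ ind Fc; have [mA _] := ind.
  have -> : [set w | F (config trap w)] = if F c then setT else set0.
    by apply/seteqP; split=> w /=; rewrite (Fc _ c) //; case: ifP.
  case: ifP => _; first by rewrite setIT (independent_traps_prob ind) mulr1.
  by rewrite setI0 measure0 mulr0.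
move=> /andP[xs us] ind Fc.
pose G b c := F (update c x b).
have Gc b c1 c2 : {in s, c1 =1 c2} -> G b c1 = G b c2.
  move=> h; apply: Fc => z; rewrite inE /update; case: eqP => //= _.
  exact: h.
have [mT PT] := IH _ _ (G true) (update c x true) us
  (independent_traps_trap mt xs ind) (Gc true).
have [mO PO] := IH _ _ (G false) (update c x false) us
  (independent_traps_open mt xs ind) (Gc false).
(* The site x is not in s and already has state b, so freezing it again changes nothing. *)
have eG b : config_mean p s (fun c => (G b c)%:R) (update c x b)
    = config_mean p s (fun c => (F c)%:R) (update c x b).
  apply: eq_config_mean => c' hc; rewrite /G; congr ((F _)%:R).
  apply/funext => z; rewrite /update; case: eqP => // ->.
  by rewrite hc // /update eqxx.
have -> : A `&` [set w | F (config trap w)]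
    = (A `&` trap x `&` [set w | G true (config trap w)])
      `|` (A `&` ~` trap x `&` [set w | G false (config trap w)]).
  have cf b w : config trap w x = b -> G b (config trap w) = F (config trap w).
    move=> e; apply: Fc => z _; rewrite /update; case: eqP => // ->.
    by rewrite e.
  apply/seteqP; split=> w /=.
    move=> [Aw Fw]; have [tw|tw] := pselect (trap x w); [left|right].
      by rewrite cf // /config mem_set.
    by rewrite cf // /config memNset.
  case=> [[[Aw tw]]|[[Aw tw]]].
    by rewrite cf // /config mem_set.
  by rewrite cf // /config memNset.
split; first exact: measurableU.
move: mT mO PT PO; set X := _ `&` _ `&` _; set Y := _ `&` _ `&` _ => mX mY PX PY.
have -> : P (X `|` Y) = (P X + P Y)%E.
  by apply: measureU => //; apply/seteqP; split=> // w [[[_ ?] _] [[_ ?] _]].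
by rewrite PX PY !eG -EFinD; congr EFin; ring.
Qed.

Lemma prob_outcome (d : measure_display) (T : measurableType d)
    (R : realType) (P : probability T R) (p : R) (trap : site -> set T) A a n x o :
  (forall y, measurable (trap y)) ->
  independent_traps P p trap A a (dependence_sites n x 1) ->
  measurable (A `&` [set w | outcome_within (config trap w) n x = o])
  /\ P (A `&` [set w | outcome_within (config trap w) n x = o])
     = (a * outcome_prob p n o)%:E.
Proof.
move=> mt ind; rewrite -(config_mean_outcome p n x o (fun=> false)).
have -> : [set w | outcome_within (config trap w) n x = o]
    = [set w | outcome_within (config trap w) n x == o].
  by apply/seteqP; split=> w /= /eqP.
apply: (prob_config (F := fun c => outcome_within c n x == o)) => //.
  exact: dependence_sites_uniq.
by move=> c c' /outcome_within_dependence -> //; rewrite mem_head.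
Qed.

(** * The limit and the conditional probability *)

Lemma win_prob_cvg (R : realType) (p b : R) : 0 < p -> p < 1 ->
  0 <= b -> b <= 1 -> (1 - p) * (1 - b + b ^+ 2) = b ->
  outcome_prob p n.+1 (Some false) @[n --> \oo]
    --> 1 - (1 - b + b ^+ 2) / (1 + b).
Proof.
move=> p0 p1 b0 b1 hb; set q := 1 - _ / _.
pose r := 1 - p ^+ 3 / 4.
have r1 : `|r| < 1.
  have h0 : 0 < p ^+ 3 by rewrite exprn_gt0.
  have h1 : p ^+ 3 <= 1 by rewrite exprn_ile1 // ltW.
  by rewrite /r ger0_norm; lra.
apply: (@squeeze_cvgr _ _ _ _ (fun n => q - 2 * r ^+ n) (fun=> q)).
- near=> n; have := win_prob_bounds n.+1 p0 p1 b0 b1 hb.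
  have := undetermined_prob_le n p0 p1; rewrite -/r -/q => h /andP[h1 h2].
  by apply/andP; split=> //; lra.
- rewrite -[X in _ --> X]subr0 -(mulr0 2).
  by apply: cvgB; [exact: cvg_cst | apply: cvgMr; exact: cvg_expr].
- exact: cvg_cst.
Unshelve. all: by end_near. Qed.

(** An increasing countable union of local events: this yields measurability and lets the
    probability be computed as a limit. *)
Lemma win_event_bigcup (T : Type) (trap : site -> set T) :
  first_player_wins_event trap
  = \bigcup_n [set w | outcome_within (config trap w) n.+1 origin = Some false].
Proof.
have E w : trap_sites trap w = [set x | config trap w x].
  apply/funext => x; apply/propext; rewrite /trap_sites /config /=.
  by split=> [/mem_set|/set_mem].
apply/seteqP; split=> w /=.
  rewrite /first_player_wins_event /= E => /first_player_winsP[n wn].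
  exists n => //=; have := outcome_within_le (config trap w) origin (leqnSn n).
  by rewrite wn /outcome_le /= => /eqP <-.
case=> n _ /= wn; rewrite /first_player_wins_event /= E.
by apply/first_player_winsP; exists n.+1.
Qed.

Theorem mainTheorem4 (R : realType) (d : measure_display)
    (T : measurableType d) (P : probability T R) (p : R)
    (trap : site -> set T)
    (hp0 : 0 < p) (hp1 : p < 1) (htrap : iid_traps P p trap) :
  measurable (first_player_wins_event trap) /\
  cond_prob P (first_player_wins_event trap) (open_event trap origin) =
    (1 - 2 * p + Num.sqrt (p / (4 - 3 * p))) / (2 * (1 - p)).
Proof.
have [mt _ _] := htrap.
set s := Num.sqrt _.
have d0 : 0 < 4 - 3 * p by lra.
have s0 : 0 <= s := sqrtr_ge0 _.
have s2 : s ^+ 2 * (4 - 3 * p) = p.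
  by rewrite sqr_sqrtr ?divfK ?gt_eqF // divr_ge0 // ltW.
have s1 : s <= 1 by nra.
pose b := (1 - s) / (1 + s).
have s1n : 1 + s != 0 by rewrite gt_eqF //; lra.
have b0 : 0 <= b by rewrite divr_ge0; lra.
have b1 : b <= 1 by rewrite /b ler_pdivrMr; lra.
have hb : (1 - p) * (1 - b + b ^+ 2) = b.
  have -> : 1 - b + b ^+ 2 = (1 + 3 * s ^+ 2) / (1 + s) ^+ 2 by rewrite /b; field.
  have -> : b = (1 - s ^+ 2) / (1 + s) ^+ 2 by rewrite /b; field.
  (* The numerators agree because s^2 (4 - 3 p) = p. *)
  by rewrite mulrA; congr (_ / _); nra.
pose E n := [set w | outcome_within (config trap w) n.+1 origin = Some false].
have E_homo : {homo E : m n / (m <= n)%N >-> m `<=` n}.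
  move=> m n mn w wm; rewrite /E /mkset in wm *.
  have := @outcome_within_le (config trap w) m.+1 n.+1 origin mn.
  by rewrite wm /outcome_le /= => /eqP <-.
have mE n : measurable (E n).
  have := prob_outcome (Some false) mt
    (independent_traps_setT (dependence_sites n.+1 origin 1) htrap).
  by rewrite setTI; case.
set O := open_event trap origin.
(* The outcome depends only on sites of positive level, hence not on the origin; its openness
   contributes a factor 1 - p. *)
have indO n : independent_traps P p trap O (1 - p) (dependence_sites n origin 1).
  rewrite /O /open_event -[X in independent_traps _ _ _ X]setTI -[1 - p]mul1r.
  apply: independent_traps_open => //; last exact: independent_traps_setT.
  by apply/negP => /dependence_sites_level; rewrite ltxx.
have mO : measurable O by case: (indO 0%N).
have mW : measurable (first_player_wins_event trap).
  by rewrite win_event_bigcup; exact: bigcupT_measurable.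
split=> //; rewrite /cond_prob (independent_traps_prob (indO 0%N)).
have -> : P (first_player_wins_event trap `&` O)
    = ((1 - p) * (1 - (1 - b + b ^+ 2) / (1 + b)))%:E.
  rewrite win_event_bigcup setIC setI_bigcupr.
  have mEO n : measurable (O `&` E n) by exact: measurableI.
  have c1 : P (O `&` E n) @[n --> \oo] --> P (\bigcup_n (O `&` E n)).
    apply: nondecreasing_cvg_mu => //; first exact: bigcupT_measurable.
    by move=> m n mn; apply/subsetPset => w [Ow Ew]; split=> //; exact: E_homo Ew.
  apply: cvg_unique c1 _ => //.
  have -> : (fun n => P (O `&` E n))
      = (fun n => ((1 - p) * outcome_prob p n.+1 (Some false))%:E).
    by apply/funext => n; case: (prob_outcome (Some false) mt (indO n.+1)).
  apply: cvg_EFin; first exact: nearW.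
  apply: cvgMr; exact: win_prob_cvg.
rewrite /= /b; have p1n : 1 - p != 0 by rewrite gt_eqF //; lra.
(* With b / (1 + b) = (1 - s) / 2, the value becomes 1 - (1 - s) / (2 (1 - p)). *)
have -> : (1 - b + b ^+ 2) = b / (1 - p) by rewrite -[in RHS]hb mulrC mulKf.
by rewrite /b; field; rewrite p1n s1n /= gt_eqF //; lra.
Qed.
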